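(* For every integer $n\ge3$, the wheel graph $W_n$ satisfies \[\operatorname{gon}(W_n)=\lceil\sqrt n\rceil-1+\left\lceil\frac{n}{\lceil\sqrt n\rceil}\right\rceil.\]
   Context: The wheel graph $W_n$ ($n\ge3$) is the simple graph on $n+1$ vertices consisting of a cycle on $n$ vertices together with one additional vertex adjacent to every vertex of the cycle. A divisor on a graph is an integer combination $D=\sum_vD(v)(v)$ of vertices with degree $\sum_vD(v)$, effective if all $D(v)\ge0$. Divisors are equivalent if their difference is in the integer column space of the Laplacian matrix. The rank $r(D)$ is $-1$ if $D$ is not equivalent to an effective divisor, else the largest $r\ge0$ such that $D-E$ is equivalent to an effective divisor for every effective $E$ of degree $r$. The gonality $\operatorname{gon}(G)$ is the minimum degree of a divisor of positive rank. *)

(* Defs.v *)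
From mathcomp Require Export all_boot all_order all_algebra.

Set Implicit Arguments.
Unset Strict Implicit.
Unset Printing Implicit Defensive.

Import Order.TTheory GRing.Theory Num.Theory.
Local Open Scope ring_scope.

(* A simple graph on m vertices is a symmetric irreflexive relation on 'I_m;
   a divisor on it is an integer column vector. *)
Section Divisors.
Variables (m : nat) (e : rel 'I_m).

Definition laplacian : 'M[int]_m :=
  \matrix_(i, j) (if i == j then #|[pred k | e i k]|%:Z else - (e i j)%:Z).

Definition divisor_degree (D : 'cV[int]_m) : int := \sum_(i < m) D i ord0.

Definition effective (D : 'cV[int]_m) : Prop := forall i, 0 <= D i ord0.

Definition equivalent (D D' : 'cV[int]_m) : Prop :=
  exists f : 'cV[int]_m, D - D' = laplacian *m f.

Definition equiv_effective (D : 'cV[int]_m) : Prop :=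
  exists2 D', effective D' & equivalent D D'.

Definition rank_at_least (D : 'cV[int]_m) (r : nat) : Prop :=
  forall E, effective E -> divisor_degree E = r%:Z -> equiv_effective (D - E).

(* The graph of the rank function: at most one r satisfies is_rank D r (lemma
   is_rank_unique), and classically some r does as soon as e is a simple graph
   with at least one vertex (lemma is_rank_exists). *)
Definition is_rank (D : 'cV[int]_m) (r : int) : Prop :=
  (~ equiv_effective D /\ r = -1) \/
  (equiv_effective D /\
   exists k : nat, [/\ r = k%:Z, rank_at_least D k
     & forall k' : nat, rank_at_least D k' -> (k' <= k)%N]).

Definition positive_rank (D : 'cV[int]_m) : Prop :=
  exists2 r, is_rank D r & 0 < r.

Definition is_gonality (d : int) : Prop :=
  (exists2 D, positive_rank D & divisor_degree D = d) /\
  (forall D, positive_rank D -> d <= divisor_degree D).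

Lemma is_rank_unique D r r' : is_rank D r -> is_rank D r' -> r = r'.
Proof.
move=> [[nD ->]|[D0 [k [-> Dk maxk]]]] [[nD' ->]|[D0' [k' [-> Dk' maxk']]]] //.
by congr Posz; apply/eqP; rewrite eqn_leq maxk // maxk'.
Qed.

Lemma is_gonality_unique d d' : is_gonality d -> is_gonality d' -> d = d'.
Proof.
move=> [[D Dp <-] mind] [[D' Dp' <-] mind'].
by apply/eqP; rewrite eq_le mind // mind'.
Qed.

Lemma equivalent_degree D D' : symmetric e -> irreflexive e ->
  equivalent D D' -> divisor_degree D = divisor_degree D'.
Proof.
move=> sym irr [f /matrixP DD']; apply/eqP; rewrite -subr_eq0 -sumrB.
rewrite (eq_bigr (fun i => \sum_j laplacian i j * f j ord0)); last first.
  by move=> i _; have := DD' i ord0; rewrite !mxE.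
rewrite exchange_big big1 // => j _; rewrite -mulr_suml.
rewrite (bigD1 j) //= mxE eqxx (eq_bigr (fun i => - (e j i)%:Z)); last first.
  by move=> i /negbTE ij; rewrite mxE ij sym.
rewrite sumrN -sum1_card -natz natr_sum.
rewrite big_mkcond (bigD1 j) //= inE irr add0r.
rewrite (eq_bigr (fun i => (e j i)%:Z)) ?subrr ?mul0r // => i _.
by rewrite inE; case: (e j i).
Qed.

Lemma is_rank_exists D : (0 < m)%N -> symmetric e -> irreflexive e ->
  ~ ~ exists r, is_rank D r.
Proof.
move=> m_gt0 sym irr nex.
have D0 : ~ ~ equiv_effective D by move=> nD; apply: nex; exists (-1); left.
apply: D0 => D0.
have degD r : rank_at_least D r -> r%:Z <= divisor_degree D.
  pose i0 := Ordinal m_gt0; pose E : 'cV[int]_m := r%:Z *: delta_mx i0 ord0.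
  have degE : divisor_degree E = r.
    rewrite /divisor_degree (bigD1 i0) //= big1 ?addr0 ?mxE ?eqxx ?mulr1 //.
    by move=> i /negbTE ii0; rewrite !mxE ii0 mulr0.
  have effE : effective E by move=> i; rewrite !mxE mulr_ge0 //; case: ifP.
  move=> /(_ E effE degE)[D' effD' /(equivalent_degree sym irr) degDE].
  rewrite -degE -subr_ge0.
  have -> : divisor_degree D - divisor_degree E = divisor_degree (D - E).
    by rewrite -sumrB; apply: eq_bigr => i _; rewrite !mxE.
  by rewrite degDE; apply: sumr_ge0 => i _; apply: effD'.
have step r : rank_at_least D r -> ~ ~ exists2 s, rank_at_least D s & (r < s)%N.
  move=> Dr nmax; apply: nex; exists r; right; split=> //; exists r; split=> //.
  by move=> s Ds; rewrite leqNgt; apply/negP => rs; apply: nmax; exists s.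
have big k : ~ ~ exists2 s, rank_at_least D s & (k <= s)%N.
  elim: k => [|k IHk] nk.
    apply: nk; exists 0%N => // E effE /eqP.
    rewrite psumr_eq0 => [/allP E0|i _]; last exact: effE.
    suff -> : E = 0 by rewrite subr0.
    apply/matrixP => i j; rewrite ord1 mxE; apply/eqP.
    by apply: E0; rewrite mem_index_enum.
  apply: IHk => -[s Ds ks]; apply: (step s Ds) => -[t Dt st].
  by apply: nk; exists t => //; apply: leq_ltn_trans st.
apply: (big `|divisor_degree D|%N.+1) => -[s /degD sD ls].
have := le_trans sD (ler_norm _); rewrite -abszE lez_nat => sD'.
by have := leq_trans ls sD'; rewrite ltnn.
Qed.

End Divisors.

(* Vertices 0, ..., n-1 form the cycle and n is the hub. *)
Definition wheel (n : nat) : rel 'I_n.+1 := fun i j =>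
  (i != j) &&
  [|| i == ord_max, j == ord_max,
      (j : nat) == (i.+1 %% n)%N | (i : nat) == (j.+1 %% n)%N].

Lemma wheel_sym n : symmetric (@wheel n).
Proof.
move=> i j; rewrite /wheel eq_sym; congr andb.
by case: (i == ord_max); case: (j == ord_max); rewrite //= orbC.
Qed.

Lemma wheel_irrefl n : irreflexive (@wheel n).
Proof. by move=> i; rewrite /wheel eqxx. Qed.

(* Main.v *)
(** Upper bound: with [k = ceil (sqrt n)], put [k - 1] chips on the hub and one
    chip on every [k]-th rim vertex.  Firing everything except one gap between
    consecutive rim chips costs the hub at most [k - 1] chips and each end of
    the gap one chip, and sends a chip to every vertex of the gap.

    Lower bound: take an effective divisor with as many hub chips [a] as
    possible.  A firing script towards an effective divisor must then be maximal
    at the hub, since otherwise firing its top level set would bring chips to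
    the hub.  If the script brings a chip to an empty rim vertex [v], the
    complement of the top level set has at most [a] vertices and contains the
    whole chip-free run around [v].  So chip-free runs have length at most [a]
    (or [n <= a]), and [b] occupied rim vertices force [n <= b (a + 1)].
    Finally [k + ceil (n / k)] is the least sum of two naturals whose product
    is at least [n]. *)

Require Import Defs.
From mathcomp Require Import zify.
From Stdlib Require Import Classical.

Set Implicit Arguments.
Unset Strict Implicit.
Unset Printing Implicit Defensive.

Import Order.TTheory GRing.Theory Num.Theory.
Local Open Scope ring_scope.

(** * Chip firing and positive rank on a general graph *)

Section ChipFiring.
Variables (m : nat) (e : rel 'I_m).
Implicit Types D E f : 'cV[int]_m.

(** Positive rank amounts to reaching every vertex; this form asks for one effective representative
    per vertex and avoids the rank function. *)
Definition reaches D (v : 'I_m) : Prop :=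
  exists2 E, effective E /\ 1 <= E v ord0 & equivalent e D E.

Lemma divisor_addE D E i : (D + E) i ord0 = D i ord0 + E i ord0 :> int.
Proof. by rewrite mxE. Qed.

Lemma divisor_subE D E i : (D - E) i ord0 = D i ord0 - E i ord0 :> int.
Proof. by rewrite !mxE. Qed.

Lemma divisor_sub_eq D E f : D - E = f ->
  forall i, D i ord0 - E i ord0 = f i ord0.
Proof. by move=> <- i; rewrite divisor_subE. Qed.

Lemma laplacian_mulE f i : irreflexive e ->
  (laplacian e *m f) i ord0 = \sum_(j | e i j) (f i ord0 - f j ord0).
Proof.
move=> irr; rewrite mxE (bigD1 i) //= mxE eqxx sumrB.
have -> : \sum_(j | e i j) f i ord0 = #|[pred k | e i k]|%:Z * f i ord0.
  by rewrite sumr_const mulrC -mulr_natr natz.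
congr (_ + _); rewrite -sumrN [RHS]big_mkcond [RHS](bigD1 i) //= irr add0r.
apply: eq_bigr => j ji; rewrite mxE eq_sym (negbTE ji).
by case: (e i j); rewrite ?mulN1r // oppr0 mul0r.
Qed.

Lemma equivalent_sym D E : equivalent e D E -> equivalent e E D.
Proof. by case=> f Df; exists (- f); rewrite mulmxN -Df opprB. Qed.

Lemma equivalent_trans D E F :
  equivalent e D E -> equivalent e E F -> equivalent e D F.
Proof.
by case=> f Df [g Eg]; exists (f + g); rewrite mulmxDr -Df -Eg addrA subrK.
Qed.

Lemma reaches_equivalent D E v :
  equivalent e D E -> reaches D v -> reaches E v.
Proof.
move=> DE [F Fv DF]; exists F => //.
exact: equivalent_trans (equivalent_sym DE) DF.
Qed.

Lemma positive_rank_reaches D v : positive_rank e D -> reaches D v.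
Proof.
case=> r [[_ ->] //|[_ [k [-> Dk _]]]] k_gt0.
(* All [k] chips are demanded at [v], so adding [E] back to the effective [F] leaves at least one
   chip there. *)
pose E : 'cV[int]_m := k%:Z *: delta_mx v ord0.
have Ev i : E i ord0 = if i == v then k%:Z else 0.
  by rewrite !mxE eqxx andbT; case: (i == v); rewrite ?mulr1 ?mulr0.
have effE : effective E by move=> i; rewrite Ev; case: ifP.
have degE : divisor_degree E = k.
  rewrite /divisor_degree (bigD1 v) //= Ev eqxx big1 ?addr0 // => i /negbTE iv.
  by rewrite Ev iv.
have [F effF [f Ff]] := Dk E effE degE.
exists (F + E); last by exists f; rewrite -Ff opprD addrA addrAC.
split=> [i|]; first by rewrite divisor_addE addr_ge0.
by rewrite divisor_addE Ev eqxx; have := effF v; lia.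
Qed.

Lemma reaches_positive_rank D : (0 < m)%N -> symmetric e -> irreflexive e ->
  (forall v, reaches D v) -> positive_rank e D.
Proof.
move=> m_gt0 sym irr Dv.
have D1 : rank_at_least e D 1.
  move=> E effE degE.
  have /existsP[v Ev] : [exists v, E v ord0 != 0].
    apply: contraT; rewrite negb_exists => /forallP E0.
    move: degE; rewrite /divisor_degree big1 // => i _.
    by apply/eqP; have := E0 i; rewrite negbK.
  have [F [effF Fv] [f Ff]] := Dv v.
  exists (F - E); last by exists f; rewrite -Ff opprB addrA subrK.
  have Ev1 : E v ord0 <= 1%:Z.
    rewrite -degE /divisor_degree (bigD1 v) //= lerDl.
    by apply: sumr_ge0 => j _; apply: effE.
  have Evi i : i != v -> E v ord0 + E i ord0 <= 1%:Z.
    move=> iv; rewrite -degE /divisor_degree (bigD1 v) //= (bigD1 i) //= addrA.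
    by rewrite lerDl; apply: sumr_ge0 => j _; apply: effE.
  move=> i; rewrite divisor_subE; have := effE v; have := effF i.
  by have [->|/Evi] := eqVneq i v; lia.
(* The existence of a rank is only known up to double negation, hence the classical step. *)
have [r Dr] := NNPP _ (is_rank_exists (D := D) m_gt0 sym irr).
exists r => //; case: Dr => [[nD _]|[_ [k [-> _ maxk]]]].
  have [E [effE _] DE] := Dv (Ordinal m_gt0).
  by case: nD; exists E.
by have := maxk _ D1.
Qed.

Lemma laplacian_max_ge0 f i : irreflexive e ->
  (forall j, f j ord0 <= f i ord0) -> 0 <= (laplacian e *m f) i ord0.
Proof.
by move=> irr fi; rewrite laplacian_mulE //; apply: sumr_ge0 => j _;
  rewrite subr_ge0.
Qed.

Lemma laplacian_max_neighbor f i j : irreflexive e ->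
  (forall k, f k ord0 <= f i ord0) -> e i j ->
  f i ord0 - f j ord0 <= (laplacian e *m f) i ord0.
Proof.
move=> irr fi eij; rewrite laplacian_mulE // (bigD1 j) //= lerDl.
by apply: sumr_ge0 => k _; rewrite subr_ge0.
Qed.

Definition max_indicator f (M : int) : 'cV[int]_m :=
  \col_i (f i ord0 == M)%:Z.

(* At a vertex where [f] is maximal, firing the level set costs at most what
   the whole script [f] costs; everywhere else chips are only gained. *)
Lemma fire_max_effective D E f (M : int) : irreflexive e ->
  effective D -> effective E -> D - E = laplacian e *m f ->
  (forall j, f j ord0 <= M) ->
  effective (D - laplacian e *m max_indicator f M).
Proof.
move=> irr effD effE DE fM i; have DEi := divisor_sub_eq DE i.
have gE j : max_indicator f M j ord0 = (f j ord0 == M)%:Z by rewrite mxE.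
rewrite divisor_subE subr_ge0 laplacian_mulE //.
have [fi|fi] := eqVneq (f i ord0) M.
  have : (laplacian e *m f) i ord0 <= D i ord0.
    by rewrite -DEi; have := effE i; lia.
  apply: le_trans; rewrite laplacian_mulE //; apply: ler_sum => j _.
  by rewrite !gE fi eqxx; have := fM j; case: eqP => /=; lia.
apply: le_trans (effD i); apply: sumr_le0 => j _.
by rewrite !gE (negbTE fi); case: eqP.
Qed.

End ChipFiring.

(** * Hub and rim coordinates on the wheel *)

Section Wheel.
Variable n : nat.
Hypothesis n_gt2 : (2 < n)%N.
Implicit Types D E f : 'cV[int]_n.+1.

Definition hub : 'I_n.+1 := ord_max.
(** Reduction modulo [n] lets [rim (v + t)] walk around the cycle past its last index. *)
Definition rim (k : nat) : 'I_n.+1 := inord (k %% n).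

Lemma rimK k : rim k = (k %% n)%N :> nat.
Proof. by rewrite inordK // ltnS ltnW // ltn_mod; lia. Qed.

Lemma rim_widen (i : 'I_n) : widen_ord (leqnSn n) i = rim i.
Proof. by apply: val_inj; rewrite /= rimK modn_small. Qed.

Lemma wheel_hub i : wheel hub i = (i != hub).
Proof. by rewrite /wheel eqxx andbT eq_sym. Qed.

Lemma rim_neq_hub k : rim k != hub.
Proof.
rewrite -val_eqE /= rimK; have : (k %% n < n)%N by rewrite ltn_mod; lia.
lia.
Qed.

Lemma wheel_rimS k : wheel (rim k.+1) (rim k).
Proof.
rewrite /wheel -(val_eqE (rim k.+1) (rim k)) /= !rimK -addn1 -modnDml addn1.
rewrite eqxx !orbT andbT; have : (k %% n < n)%N by rewrite ltn_mod; lia.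
move: (k %% n)%N => j jn; have [jn1|jn1] := eqVneq j.+1 n.
  by rewrite jn1 modnn; lia.
by rewrite modn_small; lia.
Qed.

Lemma divisor_degree_wheel D :
  divisor_degree D = \sum_(i < n) D (rim i) ord0 + D hub ord0.
Proof.
rewrite /divisor_degree big_ord_recr /=; congr (_ + _).
by apply: eq_bigr => i _; rewrite rim_widen.
Qed.

Lemma laplacian_hub f :
  (laplacian (@wheel n) *m f) hub ord0 =
  \sum_(i < n) (f hub ord0 - f (rim i) ord0).
Proof.
rewrite laplacian_mulE; last exact: wheel_irrefl.
rewrite big_mkcond big_ord_recr /= wheel_hub eqxx addr0.
by apply: eq_bigr => i _; rewrite wheel_hub rim_widen rim_neq_hub.
Qed.

(** * Lower bound: chip-free runs against hub chips *)

Definition chip_free_run D (a v : nat) : bool :=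
  [forall t : 'I_a.+1, D (rim (v + t)) ord0 == 0].

(** Each rim vertex has an occupied vertex at most [a] steps ahead, and is recovered from that
    vertex and the offset. Hence [n] is at most the number of occupied vertices times [a.+1]. *)
Lemma rim_cover D (a : nat) : effective D ->
  (forall v : 'I_n, ~~ chip_free_run D a v) ->
  exists2 b : nat, (n <= b * a.+1)%N & b%:Z <= \sum_(i < n) D (rim i) ord0.
Proof.
move=> effD cover.
pose B := [set i : 'I_n | D (rim i) ord0 != 0].
exists #|B|; last first.
  have -> : #|B|%:Z = \sum_(i < n) (D (rim i) ord0 != 0)%:Z.
    rewrite -sum1_card -natz natr_sum big_mkcond; apply: eq_bigr => i _.
    by rewrite inE; case: (_ == _).
  by apply: ler_sum => i _; have := effD (rim i); case: eqP => /=; lia.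
have n_gt0 : (0 < n)%N by lia.
pose next (t : nat) (v : 'I_n) : 'I_n := Ordinal (ltn_pmod (v + t) n_gt0).
have /fin_all_exists[t tP] (v : 'I_n) : exists t : 'I_a.+1, next t v \in B.
  have := cover v; rewrite negb_forall => /existsP[t Dt]; exists t.
  rewrite inE; congr (D _ _ != _): Dt.
  by apply: val_inj; rewrite /= !rimK /= modn_mod.
pose g v := (next (t v) v, t v).
have inj_g : injective g.
  move=> v w [/eqP vw tvw]; apply: val_inj; move: vw.
  by rewrite tvw eqn_modDr !modn_small // => /eqP.
have : (#|codom g| <= #|setX B [set: 'I_a.+1]|)%N.
  apply/subset_leq_card/subsetP => _ /codomP[v ->].
  by rewrite in_setX tP inE.
by rewrite card_codom // card_ord cardsX cardsT card_ord.
Qed.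

(** The script stays below its hub value along the run: at [v] because a chip arrives, and then
    inductively because an empty vertex at the maximum would lose a chip to its lower predecessor.
    As [a < n], these are [a.+1] distinct vertices, each costing the hub a chip, while it has only
    [a]. *)
Lemma chip_free_run_script D E f (a v : nat) : (v < n)%N -> (a < n)%N ->
  effective D -> effective E -> D - E = laplacian (@wheel n) *m f ->
  D hub ord0 = a -> chip_free_run D a v -> 1 <= E (rim v) ord0 ->
  (forall j, f j ord0 <= f hub ord0) -> False.
Proof.
move=> vn an effD effE DE Dhub /forallP run Ev fmax.
have irr := @wheel_irrefl n.
have DEi := divisor_sub_eq DE.
have lt_max t : (t <= a)%N -> f (rim (v + t)) ord0 < f hub ord0.
  elim: t => [_|t IHt ta].
    rewrite addn0 lt_neqAle fmax andbT; apply/eqP => fv.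
    have := @laplacian_max_ge0 _ (@wheel n) f (rim v) irr.
    rewrite -DEi fv => /(_ fmax).
    by have := run ord0; rewrite addn0 => /eqP ->; lia.
  rewrite lt_neqAle fmax andbT; apply/eqP => fv.
  have := @laplacian_max_neighbor _ _ f _ _ irr _ (wheel_rimS (v + t)).
  rewrite -addnS -DEi fv => /(_ fmax).
  have /eqP -> := run (Ordinal (ta : (t.+1 < a.+1)%N)).
  have := IHt (ltnW ta); have := effE (rim (v + t.+1)); lia.
have := DEi hub; rewrite laplacian_hub Dhub.
have n_gt0 : (0 < n)%N by lia.
pose next (t : 'I_a.+1) : 'I_n := Ordinal (ltn_pmod (v + t) n_gt0).
have inj_next : injective next.
  move=> t u [/eqP]; rewrite eqn_modDl !modn_small => [/eqP/val_inj //||].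
    by have := ltn_ord u; lia.
  by have := ltn_ord t; lia.
have : \sum_(i < n | i \in codom next) 1%:Z <=
       \sum_(i < n) (f hub ord0 - f (rim i) ord0).
  rewrite big_mkcond /=; apply: ler_sum => i _; case: ifP => [/codomP[t ->]|_].
    have -> : rim (next t) = rim (v + t).
      by apply: val_inj; rewrite /= !rimK /= modn_mod.
    by have := lt_max t (ltn_ord t); lia.
  by rewrite subr_ge0.
rewrite sumr_const card_codom // card_ord natz.
by have := effE hub; lia.
Qed.

Lemma reaches_degree_bound D :
  effective D -> (forall v, reaches (@wheel n) D v) ->
  exists a b : nat, (n <= b * a.+1)%N /\ a%:Z + b%:Z <= divisor_degree D.
Proof.
(* Induction on the number of chips off the hub stands in for the choice of a divisor with most hub
   chips. *)
have [N] := ubnP `|divisor_degree D - D hub ord0|%N.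
elim: N D => // N IHN D DN effD Dv.
have rim_ge0 : 0 <= \sum_(i < n) D (rim i) ord0.
  by apply: sumr_ge0 => i _; apply: effD.
have degD := divisor_degree_wheel D.
have [a Da] : exists a : nat, D hub ord0 = a.
  by exists `|D hub ord0|%N; have := effD hub; lia.
(* If [n <= a], the hub chips suffice: [a.-1] and 1 have sum [a], and the product [1 * a.-1.+1] is
   also [a]. *)
have [na|an] := leqP n a.
  by exists a.-1, 1%N; split; [lia | rewrite degD Da; lia].
have [/existsP[v run]|] := boolP [exists v : 'I_n, chip_free_run D a v];
  last first.
  rewrite negb_exists => /forallP /(rim_cover effD)[b nb bD].
  by exists a, b; split=> //; rewrite degD Da; lia.
have [E [effE Ev] [f DE]] := Dv (rim v).
pose M := f [arg max_(i > hub) f i ord0]%O ord0.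
have fM j : f j ord0 <= M.
  by rewrite /M; case: arg_maxP => // i _ /(_ j isT).
have [fhub|fhub] := eqVneq (f hub ord0) M.
  by case: (chip_free_run_script (ltn_ord v) an effD effE DE Da run Ev) => j;
    rewrite fhub.
pose g := max_indicator f M; pose D' : 'cV[int]_n.+1 := D - laplacian (@wheel n) *m g.
have DD' : equivalent (@wheel n) D D' by exists g; rewrite opprB addrC subrK.
have degD' := equivalent_degree (@wheel_sym n) (@wheel_irrefl n) DD'.
have effD' : effective D'.
  exact: fire_max_effective (@wheel_irrefl n) effD effE DE fM.
rewrite degD'; apply: IHN => // [|u]; last exact: reaches_equivalent DD' (Dv u).
(* The top level set is nonempty and avoids the hub, to which each of its vertices is adjacent. *)
have hub_gain : 1 <= D' hub ord0 - D hub ord0.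
  rewrite divisor_subE addrAC subrr sub0r laplacian_mulE; last first.
    exact: wheel_irrefl.
  set w := [arg max_(i > hub) f i ord0]%O in M fM fhub g D' DD' degD' effD' *.
  have whub : w != hub by apply: contraNneq fhub => <-.
  rewrite -sumrN (bigD1 w) ?wheel_hub //= !mxE eqxx (negbTE fhub).
  rewrite sub0r opprK lerDl; apply: sumr_ge0 => j _.
  by rewrite ?mxE ?(negbTE fhub) sub0r opprK.
rewrite -degD'; have : 0 <= divisor_degree D' - D' hub ord0.
  rewrite divisor_degree_wheel addrK.
  by apply: sumr_ge0 => i _; apply: effD'.
by rewrite -degD'; lia.
Qed.

(** * Upper bound: the spread divisor and its gaps *)

Section UpperBound.
Variable k : nat.
Hypothesis k_gt1 : (1 < k)%N.
Hypothesis k_lt_n : (k < n)%N.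

Definition spread_divisor : 'cV[int]_n.+1 :=
  \col_i (if i == hub then k.-1%:Z else (k %| i)%N%:Z).

Lemma spread_effective : effective spread_divisor.
Proof. by move=> i; rewrite mxE; case: ifP. Qed.

(** The bound [j < n] cuts the last gap short and also keeps out the hub, whose index is [n]. *)
Definition gap (q : nat) : pred 'I_n.+1 :=
  fun j => (q * k < j < q.+1 * k)%N && (j < n)%N.

Lemma card_gap q : \sum_(i < n) (gap q (rim i))%:Z <= k.-1%:Z.
Proof.
have -> : \sum_(i < n) (gap q (rim i))%:Z =
          #|[pred i : 'I_n | gap q (rim i)]|%:Z.
  rewrite -sum1_card -natz natr_sum [RHS]big_mkcond; apply: eq_bigr => i _.
  by rewrite inE; case: (gap _ _).
rewrite lez_nat cardE -(size_map val) -(size_iota (q * k).+1 k.-1).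
apply: uniq_leq_size.
  by rewrite map_inj_uniq ?enum_uniq //; apply: val_inj.
move=> x /mapP[i]; rewrite mem_enum inE /gap rimK modn_small // => qi ->.
by rewrite mem_iota; move: qi; rewrite mulSn /=; lia.
Qed.

Lemma gap_boundary q i j : i != hub -> ~~ gap q i -> gap q j -> wheel i j ->
  (k %| i)%N /\ i = (j.+1 %% n)%N :> nat \/
  i = (q * k)%N :> nat /\ j = i.+1 :> nat.
Proof.
rewrite /wheel /gap -!val_eqE /= => ih gi gj.
have jn : (j < n)%N by lia.
have i_n : (i < n)%N by have := ltn_ord i; lia.
case/andP => _ /or4P[/eqP|/eqP|/eqP|/eqP]; try lia.
  have [->|in1] := eqVneq i.+1 n; first by rewrite modnn; lia.
  by rewrite modn_small; [right; lia | lia].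
have [jn1|jn1] := eqVneq j.+1 n.
  by rewrite jn1 modnn => i0; left; rewrite i0 dvdn0.
rewrite modn_small; last lia.
move=> ij; left; split=> //.
by have -> : i = (q.+1 * k)%N :> nat; [lia | rewrite dvdn_mull].
Qed.

(** Only the two ends of a gap touch it, and both carry a chip. One vertex could be both ends only
    if the gap filled the rest of the cycle, which [k < n] forbids. *)
Lemma gap_neighbor_le q i : i != hub -> ~~ gap q i ->
  \sum_(j | wheel i j) (gap q j)%:Z <= (k %| i)%N%:Z.
Proof.
move=> ih gi.
have [j /andP[wij gj]|none] := pickP [pred j | wheel i j && gap q j]; last first.
  by rewrite big1 // => j wij; have := none j; rewrite /= wij /= => ->.
have ki : (k %| i)%N.
  by case: (gap_boundary ih gi gj wij) => [[]|[-> _]] //; rewrite dvdn_mull.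
rewrite (bigD1 j) //= gj big1 ?ki // => l /andP[wil lj].
case gl: (gap q l) => //; case/eqP: lj; apply: val_inj => /=.
have := gap_boundary ih gi gj wij; have := gap_boundary ih gi gl wil.
move: (gl) (gj); rewrite /gap => gl' gj'.
have mod1 (u : 'I_n.+1) :
    gap q u -> (u.+1 %% n = if u.+1 == n then 0 else u.+1)%N.
  rewrite /gap => gu; have [->|un] := eqVneq u.+1 n; first by rewrite modnn.
  by rewrite modn_small; lia.
rewrite !mod1 //; case: ifP => /eqP lnn; case: ifP => /eqP jnn.
all: by move=> [[_ il]|[iq il]] [[_ ij]|[iq' ij]]; try lia; nia.
Qed.

Lemma spread_reaches v : reaches (@wheel n) spread_divisor v.
Proof.
have irr := @wheel_irrefl n.
have here : 1 <= spread_divisor v ord0 -> reaches (@wheel n) spread_divisor v.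
  move=> Dv; exists spread_divisor; first by split=> //; apply: spread_effective.
  by exists 0; rewrite subrr mulmx0.
have [vh|vh] := eqVneq v hub; first by apply: here; rewrite mxE vh eqxx; lia.
have [kv|kv] := boolP (k %| v)%N.
  by apply: here; rewrite mxE (negbTE vh) kv.
(* Constant scripts move no chips, so minus the indicator of the gap fires its complement. *)
pose q := (v %/ k)%N; pose f : 'cV[int]_n.+1 := \col_j - (gap q j)%:Z.
have fE j : f j ord0 = - (gap q j)%:Z by rewrite mxE.
have gv : gap q v.
  rewrite /gap /q; have := divn_eq v k.
  have : (v %% k < k)%N by rewrite ltn_mod; lia.
  have : (v %% k)%N != 0%N by [].
  have := ltn_ord v; move: vh; rewrite -val_eqE /= mulSn.
  by move: (v %/ k * k)%N (v %% k)%N => x y; lia.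
have gh : gap q hub = false by rewrite /gap /= ltnn andbF.
pose E : 'cV[int]_n.+1 := spread_divisor - laplacian (@wheel n) *m f.
have EE i : E i ord0 = spread_divisor i ord0 -
    \sum_(j | wheel i j) ((gap q j)%:Z - (gap q i)%:Z).
  rewrite divisor_subE laplacian_mulE //; congr (_ - _); apply: eq_bigr => j _.
  by rewrite !fE opprK addrC.
have E_gap i : gap q i -> 1 <= E i ord0.
  move=> gi; have ih : i != hub by apply: contraTneq gi => ->; rewrite gh.
  have wih : wheel i hub by rewrite wheel_sym wheel_hub.
  rewrite EE (bigD1 hub) //= gh gi.
  have := spread_effective i.
  have : \sum_(j | wheel i j && (j != hub)) ((gap q j)%:Z - 1) <= 0.
    by apply: sumr_le0 => j _; case: (gap q j).
  by set x := \sum_(_ | _) _; lia.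
exists E; last by exists f; rewrite opprB addrC subrK.
split; last exact: E_gap.
move=> i; have [gi|gi] := boolP (gap q i); first by have := E_gap i gi; lia.
rewrite EE subr_ge0 (negbTE gi) mxE.
under eq_bigr do rewrite subr0.
case: eqVneq => [->|ih]; last exact: gap_neighbor_le.
apply: le_trans (card_gap q).
rewrite big_mkcond big_ord_recr /= wheel_hub eqxx addr0.
by apply: ler_sum => j _; rewrite rim_widen; case: ifP.
Qed.

End UpperBound.

(** The two inequalities say, without division, that the count is the ceiling of [N / k]. *)
Lemma count_multiples (k N : nat) : (0 < k)%N ->
  (N <= (\sum_(i < N) (k %| i)) * k < N + k)%N.
Proof.
move=> k_gt0; elim: N => [|N IHN]; first by rewrite big_ord0; lia.
rewrite big_ord_recr /=; move: (\sum_(i < N) _)%N IHN => c IHN.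
have [/dvdnP[x xN]|kN] := boolP (k %| N)%N.
  have -> : c = x by nia.
  by subst N; nia.
suff : N != (c * k)%N by lia.
by apply: contraNneq kN => ->; rewrite dvdn_mull.
Qed.

Lemma spread_degree (k b : nat) : (0 < k)%N -> (b.-1 * k < n <= b * k)%N ->
  divisor_degree (spread_divisor k) = k.-1%:Z + b%:Z.
Proof.
move=> k_gt0 bn; rewrite divisor_degree_wheel mxE eqxx addrC; congr (_ + _).
have := count_multiples n k_gt0.
have -> : \sum_(i < n) spread_divisor k (rim i) ord0 =
          (\sum_(i < n) (k %| i))%N%:Z.
  rewrite -natz natr_sum; apply: eq_bigr => i _.
  by rewrite mxE (negbTE (rim_neq_hub _)) rimK modn_small // natz.
by move: (\sum_(i < n) _)%N => c cn; congr Posz; nia.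
Qed.
End Wheel.

(** * Arithmetic of the two ceilings, and the gonality *)

Lemma add_ceil_sqrt_min (n k b x y : nat) :
  (k.-1 ^ 2 < n <= k ^ 2)%N -> (b.-1 * k < n <= b * k)%N -> (n <= x * y)%N ->
  (k + b <= x + y)%N.
Proof.
move=> /andP[kn nk] /andP[bn nb] nxy.
rewrite leqNgt; apply/negP => xy.
have k0 : (0 < k)%N by lia.
have b0 : (0 < b)%N by lia.
(* From here [k] and [b] denote the predecessors. The bounds leave only [b = k] and [b.+1 = k];
   since [4 * (x * y) <= (x + y) ^ 2], a smaller sum gives [x * y <= k * k.+1] or [x * y <= k ^ 2]
   respectively, each below [n]. *)
case: k kn nk bn nb xy k0 => // k; case: b b0 => // b _ /= kn nk bn nb xy _.
have bk : (k <= b.+1)%N by nia.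
have bk' : (b <= k)%N by nia.
have [ebk|ebk] : b = k \/ b.+1 = k by lia.
  have : ((x + y) ^ 2 <= (k + k.+1) ^ 2)%N by rewrite leq_exp2r //; lia.
  by have := (nat_AGM2 x y).1; subst b; nia.
have : ((x + y) ^ 2 <= (k + k) ^ 2)%N by rewrite leq_exp2r //; lia.
by have := (nat_AGM2 x y).1; nia.
Qed.

Lemma ceil_sqrt_nat (R : archiRcfType) (n : nat) : (0 < n)%N ->
  exists2 k : nat, Num.ceil (Num.sqrt (n%:R : R)) = k%:Z
    & (k.-1 ^ 2 < n <= k ^ 2)%N.
Proof.
move=> n_gt0; set s := Num.sqrt _.
have s_gt0 : 0 < s by rewrite sqrtr_gt0 ltr0n.
have sE : s ^+ 2 = n%:R by rewrite sqr_sqrtr // ler0n.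
have : 0 < Num.ceil s by rewrite ceil_gt0.
have := ceil_itv s; case: (Num.ceil s) => // -[|k] // /andP[ks sk] _.
exists k.+1 => //=; apply/andP; split.
  rewrite -(ltr_nat R) natrX -sE ltrXn2r // ?ler0n //.
  by move: ks; rewrite -addn1 PoszD addrK.
by rewrite -(ler_nat R) natrX -sE lerXn2r // nnegrE ?ltW ?ler0n.
Qed.

Lemma ceil_div_nat (R : archiRcfType) (n k : nat) : (0 < n)%N -> (0 < k)%N ->
  exists2 b : nat, Num.ceil ((n%:R : R) / k%:Z%:~R) = b%:Z
    & (b.-1 * k < n <= b * k)%N.
Proof.
move=> n_gt0 k_gt0; set s := _ / _.
have kR : 0 < k%:R :> R by rewrite ltr0n.
have s_gt0 : 0 < s by rewrite divr_gt0 // ltr0n.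
have sE : s * k%:R = n%:R by rewrite divfK // gt_eqF.
have : 0 < Num.ceil s by rewrite ceil_gt0.
have := ceil_itv s; case: (Num.ceil s) => // -[|b] // /andP[bs sb] _.
exists b.+1 => //=; apply/andP; split.
  rewrite -(ltr_nat R) natrM -sE ltr_pM2r //.
  by move: bs; rewrite -addn1 PoszD addrK.
by rewrite -(ler_nat R) natrM -sE ler_pM2r.
Qed.

Theorem theorem5p2 (R : archiRcfType) (n : nat) (hn : (3 <= n)%N) :
  is_gonality (@wheel n)
    (Num.ceil (Num.sqrt (n%:R : R)) - 1
     + Num.ceil ((n%:R : R) / (Num.ceil (Num.sqrt (n%:R : R)))%:~R)).
Proof.
have n_gt0 : (0 < n)%N by lia.
have [k -> kn] := ceil_sqrt_nat R n_gt0.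
have k_gt0 : (0 < k)%N by lia.
have [b -> bn] := ceil_div_nat R n_gt0 k_gt0.
have k_gt1 : (1 < k)%N by case: k kn {bn k_gt0} => [|[|k]]; lia.
have k_lt_n : (k < n)%N by nia.
have -> : k%:Z - 1 + b%:Z = k.-1%:Z + b%:Z by lia.
split.
  exists (spread_divisor n k); last exact: spread_degree.
  apply: reaches_positive_rank; [by []|exact: wheel_sym|exact: wheel_irrefl|].
  exact: spread_reaches.
(* [D] need not be effective; reaching any vertex, here the hub, supplies an effective
   representative of the same degree. *)
move=> D Dpos; have [E [effE _] DE] := positive_rank_reaches (hub n) Dpos.
have Ev v : reaches (@wheel n) E v.
  exact: reaches_equivalent DE (positive_rank_reaches v Dpos).
rewrite (equivalent_degree (@wheel_sym n) (@wheel_irrefl n) DE).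
have [x [y [nxy degE]]] := reaches_degree_bound hn effE Ev.
apply: le_trans degE; have := add_ceil_sqrt_min kn bn nxy; lia.
Qed.
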